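(* For $\theta\in[0,2\pi]$ write $\widehat c=\cos\frac\theta2$, $\widehat s=\sin\frac\theta2$, and let $\beta\in\mathbf{R}$. Let $R_{1,2}$, $R_{3,4}$ be the $4\times4$ standard Givens matrices with angle $\theta$ and $H_{1,3}$, $H_{2,4}$ the $4\times 4$ hyperbolic Givens matrices with parameter $\beta$. Then their preimages under $\Phi_{2,2}:\mathrm{Spin}^{+}(2,2)\to SO^{+}(2,2)$, with $\mathrm{Spin}^{+}(2,2)\cong SL(2,\mathbf{R})\times SL(2,\mathbf{R})$ viewed inside $M(4,\mathbf{R})$, are $$\Phi_{2,2}^{-1}(R_{1,2})=\left\{\pm\begin{pmatrix} \widehat c & 0 & 0 & -\widehat s \\ 0 & \widehat c & -\widehat s & 0 \\ 0 & \widehat s & \widehat c & 0 \\ \widehat s & 0 & 0 & \widehat c \end{pmatrix}\right\},\qquad \Phi_{2,2}^{-1}(R_{3,4})=\left\{\pm\begin{pmatrix} \widehat c & 0 & 0 & \widehat s \\ 0 & \widehat c & -\widehat s & 0 \\ 0 & \widehat s & \widehat c & 0 \\ -\widehat s & 0 & 0 & \widehat c \end{pmatrix}\right\},$$ $$\Phi_{2,2}^{-1}(H_{1,3})=\{\pm\mathrm{diag}(e^{\beta/2},e^{-\beta/2},e^{\beta/2},e^{-\beta/2})\},\qquad \Phi_{2,2}^{-1}(H_{2,4})=\{\pm\mathrm{diag}(e^{\beta/2},e^{\beta/2},e^{-\beta/2},e^{-\beta/2})\}.$$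
   Context: Let $\sigma_x=\begin{pmatrix} 0 & 1 \\ 1 & 0 \end{pmatrix}$, $i\sigma_y=\begin{pmatrix} 0 & 1 \\ -1 & 0 \end{pmatrix}$, $\sigma_z=\mathrm{diag}(1,-1)$. The basis of one-vectors of $\mathrm{Cl}(2,2)=M(4,\mathbf{R})$ is $X_1=\sigma_z\otimes\sigma_x$, $X_2=\sigma_x\otimes I_2$, $X_3=\sigma_z\otimes(i\sigma_y)$, $X_4=(i\sigma_y)\otimes I_2$ (Kronecker products). $\mathrm{Spin}^{+}(2,2)$ is the group of matrices $$Y=\begin{pmatrix} y_1 & 0 & 0 & y_2 \\ 0 & y_3 & y_4 & 0 \\ 0 & y_5 & y_6 & 0 \\ y_7 & 0 & 0 & y_8 \end{pmatrix}\in M(4,\mathbf{R}),\qquad y_1y_8-y_2y_7=1,\quad y_3y_6-y_4y_5=1,$$ i.e. the pair $\begin{pmatrix} y_1 & y_2 \\ y_7 & y_8 \end{pmatrix},\begin{pmatrix} y_3 & y_4 \\ y_5 & y_6 \end{pmatrix}$ in $SL(2,\mathbf{R})\times SL(2,\mathbf{R})$ embedded in $M(4,\mathbf{R})$. $\Phi_{2,2}(Y)$ is the $4\times4$ matrix of the linear map $V\mapsto YVY^{-1}$ on $\mathrm{span}_{\mathbf{R}}\{X_1,\dots,X_4\}$ with respect to this ordered basis (column $j$ holds the coordinates of $YX_jY^{-1}$). $SO^{+}(2,2)$ is the identity component of $\{X\in M(4,\mathbf{R}):X^TI_{2,2}X=I_{2,2},\det X=1\}$, $I_{2,2}=\mathrm{diag}(1,1,-1,-1)$.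 $R_{i,j}$ is the identity except in the principal submatrix on rows and columns $(i,j)$, where it is $\begin{pmatrix} \cos\theta & -\sin\theta \\ \sin\theta & \cos\theta \end{pmatrix}$; $H_{i,j}$ is the identity except in the principal submatrix on rows and columns $(i,j)$, where it is $\begin{pmatrix} \cosh\beta & \sinh\beta \\ \sinh\beta & \cosh\beta \end{pmatrix}$. *)

(* Defs.v *)
From HB Require Import structures.
From mathcomp Require Import all_boot all_order all_algebra.
From mathcomp Require Import all_classical all_reals all_analysis.
From mathcomp Require Import mxtens.

Set Implicit Arguments.
Unset Strict Implicit.
Unset Printing Implicit Defensive.

Import Order.TTheory GRing.Theory Num.Theory numFieldNormedType.Exports.

Local Open Scope ring_scope.
Local Open Scope classical_set_scope.

Definition mx_of_rows (R : realType) (n : nat) (s : seq (seq R)) : 'M[R]_n :=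
  \matrix_(i, j) nth 0 (nth [::] s i) j.

Definition cosh (R : realType) (x : R) : R := (expR x + expR (- x)) / 2.
Definition sinh (R : realType) (x : R) : R := (expR x - expR (- x)) / 2.

Definition sigma_x (R : realType) : 'M[R]_2 :=
  mx_of_rows 2 [:: [:: 0; 1]; [:: 1; 0]].
Definition isigma_y (R : realType) : 'M[R]_2 :=
  mx_of_rows 2 [:: [:: 0; 1]; [:: -1; 0]].
Definition sigma_z (R : realType) : 'M[R]_2 :=
  mx_of_rows 2 [:: [:: 1; 0]; [:: 0; -1]].

(* 'M_(2 * 2), the type of the Kronecker product, is convertible to 'M_4. *)
Definition kron (R : realType) (A B : 'M[R]_2) : 'M[R]_4 := A *t B.

Definition one_vectors (R : realType) : 4.-tuple 'M[R]_4 :=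
  [tuple kron (sigma_z R) (sigma_x R); kron (sigma_x R) 1%:M;
         kron (sigma_z R) (isigma_y R); kron (isigma_y R) 1%:M].

Definition Spin22 (R : realType) : set 'M[R]_4 :=
  [set Y | exists y1 y2 y3 y4 y5 y6 y7 y8 : R,
     [/\ Y = mx_of_rows 4 [:: [:: y1; 0;  0;  y2];
                              [:: 0;  y3; y4; 0];
                              [:: 0;  y5; y6; 0];
                              [:: y7; 0;  0;  y8]],
         y1 * y8 - y2 * y7 = 1 & y3 * y6 - y4 * y5 = 1]].

(* The coordinates given by coord are meaningful on the span of the tuple,
   which conjugation by an element of Spin22 preserves. *)
Definition Phi22 (R : realType) (Y : 'M[R]_4) : 'M[R]_4 :=
  \matrix_(i, j)
    coord (one_vectors R) i (Y *m tnth (one_vectors R) j *m invmx Y).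

Definition Phi22_preimage (R : realType) (X : 'M[R]_4) : set 'M[R]_4 :=
  [set Y | Spin22 Y /\ Phi22 Y = X].

Definition I22 (R : realType) : 'M[R]_4 :=
  mx_of_rows 4 [:: [:: 1; 0; 0; 0]; [:: 0; 1; 0; 0];
                   [:: 0; 0; -1; 0]; [:: 0; 0; 0; -1]].

Definition SO22 (R : realType) : set 'M[R]_4 :=
  [set X | X^T *m I22 R *m X = I22 R /\ \det X = 1].

Definition SO22plus (R : realType) : set 'M[R]_4 :=
  connected_component (@SO22 R) 1%:M.

(* The identity matrix, with the principal submatrix on the rows and columns
   (i, j) replaced by [a, b; c, d]. *)
Definition plane_mx (R : realType) (n : nat) (i j : 'I_n) (a b c d : R) :
    'M[R]_n :=
  \matrix_(k, l) if (k == i) && (l == i) then a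
                 else if (k == i) && (l == j) then b
                 else if (k == j) && (l == i) then c
                 else if (k == j) && (l == j) then d
                 else (k == l)%:R.

Definition givens (R : realType) (n : nat) (i j : 'I_n) (theta : R) :=
  plane_mx i j (cos theta) (- sin theta) (sin theta) (cos theta).

Definition hgivens (R : realType) (n : nat) (i j : 'I_n) (beta : R) :=
  plane_mx i j (cosh beta) (sinh beta) (sinh beta) (cosh beta).

(* Ordinals start at 0, hence the shift of the indices. *)
Definition R12 (R : realType) (theta : R) : 'M[R]_4 :=
  givens (0 : 'I_4) (1 : 'I_4) theta.
Definition R34 (R : realType) (theta : R) : 'M[R]_4 :=
  givens (2 : 'I_4) (3 : 'I_4) theta.
Definition H13 (R : realType) (beta : R) : 'M[R]_4 :=
  hgivens (0 : 'I_4) (2 : 'I_4) beta.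
Definition H24 (R : realType) (beta : R) : 'M[R]_4 :=
  hgivens (1 : 'I_4) (3 : 'I_4) beta.

(* Main.v *)
Require Import Defs.
From HB Require Import structures.
From mathcomp Require Import all_boot all_order all_algebra.
From mathcomp Require Import all_classical all_reals all_analysis.
From mathcomp Require Import ring lra.

(* Identify the span of the one-vectors with the 2x2 real matrices M. Then a
   pair (P, Q) in SL(2,R) x SL(2,R) acts by M |-> P M Q^-1, which preserves the
   quadratic form - det M and whose matrix is bilinear in the entries of P
   and Q. It determines all the products of an entry of P and an entry of Q,
   hence (P, Q) up to a common sign, so that it suffices to exhibit one preimage
   of each Givens matrix. The image lies in the identity component because
   every element of SL(2,R) is a product of elementary matrices, and is
   therefore joined to the identity by a path. *)

Import Order.TTheory GRing.Theory Num.Theory numFieldNormedType.Exports.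

Local Open Scope ring_scope.
Local Open Scope classical_set_scope.

(** * Entries, products and determinants of small matrices *)

Lemma sum_ord4 (V : nmodType) (F : 'I_4 -> V) :
  \sum_(i < 4) F i = F 0 + F 1 + F 2 + F 3.
Proof.
rewrite !big_ord_recl big_ord0 addr0 !addrA.
by congr (F _ + F _ + F _ + F _); apply: val_inj.
Qed.

Lemma mx_of_rowsE {R : realType} n (s : seq (seq R)) (i j : 'I_n) :
  mx_of_rows n s i j = nth 0 (nth [::] s i) j.
Proof. exact: mxE. Qed.

(** Membership in an explicit list lets [entries] substitute the numerals 0 to 3 for the indices,
    which the entrywise rewriting rules then match. *)
Lemma mx4P (T : Type) (A B : 'M[T]_4) :
  (forall i j : 'I_4, i \in [:: 0; 1; 2; 3] -> j \in [:: 0; 1; 2; 3] ->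
     A i j = B i j) -> A = B.
Proof.
have all4 (i : 'I_4) : i \in [:: 0; 1; 2; 3] by case: i => [[|[|[|[|?]]]] ?].
by move=> AB; apply/matrixP => i j; apply: AB.
Qed.

Ltac entries :=
  apply: mx4P => i j; rewrite !inE;
  case/or4P => /eqP ->; case/or4P => /eqP ->.

Lemma mulmx4E {R : pzSemiRingType} (A B : 'M[R]_4) i j :
  (A *m B) i j = A i 0 * B 0 j + A i 1 * B 1 j + A i 2 * B 2 j + A i 3 * B 3 j.
Proof. by rewrite mxE sum_ord4. Qed.

Lemma ord2P (i : 'I_2) : i = 0 \/ i = 1.
Proof.
by case: i => [[|[|?]] ?]; [left|right|]; rewrite //; apply: val_inj.
Qed.

Lemma mx2P (T : Type) (A B : 'M[T]_2) :
  A 0 0 = B 0 0 -> A 0 1 = B 0 1 -> A 1 0 = B 1 0 -> A 1 1 = B 1 1 -> A = B.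
Proof.
move=> *; apply/matrixP => i j.
by case: (ord2P i) => ->; case: (ord2P j) => ->.
Qed.

Lemma mulmx2E {R : pzSemiRingType} (A B : 'M[R]_2) i j :
  (A *m B) i j = A i 0 * B 0 j + A i 1 * B 1 j.
Proof.
rewrite mxE !big_ord_recl big_ord0 addr0.
by congr (A i _ * B _ j + A i _ * B _ j); apply: val_inj.
Qed.

Lemma det_mx22 (R : comNzRingType) (A : 'M[R]_2) :
  \det A = A 0 0 * A 1 1 - A 0 1 * A 1 0.
Proof.
rewrite (expand_det_row _ 0) !big_ord_recl big_ord0 /cofactor !det_mx11 !mxE /=.
have -> : lift 0 (0 : 'I_1) = 1 :> 'I_2 by apply: val_inj.
have -> : lift 1 (0 : 'I_1) = 0 :> 'I_2 by apply: val_inj.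
by rewrite expr0 expr1; ring.
Qed.

(** Laplace expansion along the first two rows: each of their minors is paired with the
    complementary one. *)
Lemma det_mx_of_rows4 {R : realType} (a0 a1 a2 a3 b0 b1 b2 b3 c0 c1 c2 c3
    d0 d1 d2 d3 : R) :
  \det (mx_of_rows 4 [:: [:: a0; a1; a2; a3]; [:: b0; b1; b2; b3];
                         [:: c0; c1; c2; c3]; [:: d0; d1; d2; d3]]) =
  (a0 * b1 - a1 * b0) * (c2 * d3 - c3 * d2)
  - (a0 * b2 - a2 * b0) * (c1 * d3 - c3 * d1)
  + (a0 * b3 - a3 * b0) * (c1 * d2 - c2 * d1)
  + (a1 * b2 - a2 * b1) * (c0 * d3 - c3 * d0)
  - (a1 * b3 - a3 * b1) * (c0 * d2 - c2 * d0)
  + (a2 * b3 - a3 * b2) * (c0 * d1 - c1 * d0).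
Proof.
rewrite (expand_det_row _ 0) sum_ord4 /cofactor.
rewrite !(expand_det_row _ (ord0 : 'I_3)) !big_ord_recl !big_ord0 /cofactor.
by rewrite !det_mx22 !mxE /=; ring.
Qed.

(** * Conjugation on one-vectors, in coordinates *)

Definition spin_mx {R : realType} (P Q : 'M[R]_2) : 'M[R]_4 :=
  mx_of_rows 4 [:: [:: P 0 0; 0; 0; P 0 1]; [:: 0; Q 0 0; Q 0 1; 0];
                   [:: 0; Q 1 0; Q 1 1; 0]; [:: P 1 0; 0; 0; P 1 1]].

(* The block on rows 0, 3 and columns 1, 2 is M = [a, b; c, -d], the one on
   rows 1, 2 and columns 0, 3 is - \adj M. *)
Definition one_vector {R : realType} (a b c d : R) : 'M[R]_4 :=
  mx_of_rows 4 [:: [:: 0; a; b; 0]; [:: d; 0; 0; b];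
                   [:: c; 0; 0; - a]; [:: 0; c; - d; 0]].

(* Here P *m M *m \adj Q = [a', b'; c', -d'], with M = [a, b; c, -d]. *)
Definition conj_coords {R : realType} (P Q : 'M[R]_2) (a b c d : R) : seq R :=
  let a' := (P 0 0 * a + P 0 1 * c) * Q 1 1 - (P 0 0 * b - P 0 1 * d) * Q 1 0 in
  let b' := (P 0 0 * b - P 0 1 * d) * Q 0 0 - (P 0 0 * a + P 0 1 * c) * Q 0 1 in
  let c' := (P 1 0 * a + P 1 1 * c) * Q 1 1 - (P 1 0 * b - P 1 1 * d) * Q 1 0 in
  let d' := (P 1 0 * a + P 1 1 * c) * Q 0 1 - (P 1 0 * b - P 1 1 * d) * Q 0 0 in
  [:: (a' + d') / 2; (b' + c') / 2; (a' - d') / 2; (b' - c') / 2].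

(** Transposed because the image of each one-vector must form a column. *)
Definition Phi_mx {R : realType} (P Q : 'M[R]_2) : 'M[R]_4 :=
  (mx_of_rows 4 [:: conj_coords P Q 1 0 0 1; conj_coords P Q 0 1 1 0;
                    conj_coords P Q 1 0 0 (-1);
                    conj_coords P Q 0 1 (-1) 0])^T.

Lemma Phi_mxE {R : realType} (P Q : 'M[R]_2) (i j : 'I_4) : Phi_mx P Q i j =
  nth 0 (nth [::] [:: conj_coords P Q 1 0 0 1; conj_coords P Q 0 1 1 0;
    conj_coords P Q 1 0 0 (-1); conj_coords P Q 0 1 (-1) 0] j) i.
Proof. by rewrite mxE mx_of_rowsE. Qed.

Lemma Spin22P {R : realType} (Y : 'M[R]_4) :
  Spin22 Y <-> exists P Q, [/\ Y = spin_mx P Q, \det P = 1 & \det Q = 1].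
Proof.
split=> [[y1 [y2 [y3 [y4 [y5 [y6 [y7 [y8 [-> detP detQ]]]]]]]]]|].
  exists (mx_of_rows 2 [:: [:: y1; y2]; [:: y7; y8]]).
  exists (mx_of_rows 2 [:: [:: y3; y4]; [:: y5; y6]]).
  by rewrite !det_mx22; split; rewrite /spin_mx !mx_of_rowsE.
move=> [P [Q [-> detP detQ]]].
exists (P 0 0), (P 0 1), (Q 0 0), (Q 0 1), (Q 1 0), (Q 1 1), (P 1 0), (P 1 1).
by rewrite -!det_mx22.
Qed.

(** The corresponding 2x2 matrices M are [sigma_z], [sigma_x], the identity and [isigma_y]. *)
Lemma one_vectorsE (R : realType) :
  one_vectors R =
  [:: one_vector 1 0 0 1; one_vector 0 1 1 0;
      one_vector 1 0 0 (-1); one_vector 0 1 (-1) 0] :> seq 'M[R]_4.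
Proof.
by congr [:: _; _; _; _]; entries; rewrite !mxE /=;
  rewrite ?(mulr0, mul0r, mulr1, mul1r, mulrN1, mulN1r, oppr0, opprK).
Qed.

(** Solving these four relations for [k] gives the half sums and half differences in
    [conj_coords]. *)
Lemma one_vectors_sum (R : realType) (k : 'I_4 -> R) :
  \sum_(i < 4) k i *: (one_vectors R)`_i =
  one_vector (k 0 + k 2) (k 1 + k 3) (k 1 - k 3) (k 0 - k 2).
Proof.
rewrite one_vectorsE sum_ord4 /=.
by entries; rewrite !mxE /=; ring.
Qed.

Lemma one_vectors_free (R : realType) : free (one_vectors R).
Proof.
apply/freeP => k; rewrite one_vectors_sum => /matrixP k0.
move: (k0 0 1) (k0 0 2) (k0 1 0) (k0 2 0); rewrite !mxE /= => e1 e2 e3 e4.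
have zero : [/\ k 0 = 0, k 1 = 0, k 2 = 0 & k 3 = 0] by split; lra.
by case: zero => z0 z1 z2 z3 [[|[|[|[|?]]]] lti] //;
  [rewrite -z0|rewrite -z1|rewrite -z2|rewrite -z3]; congr k; apply: val_inj.
Qed.

Lemma spin_mx_unit {R : realType} (P Q : 'M[R]_2) :
  \det P = 1 -> \det Q = 1 -> spin_mx P Q \in unitmx.
Proof.
rewrite !det_mx22 => detP detQ.
(* [S] is built from the adjugates of [P] and [Q]. *)
pose S := mx_of_rows 4 [:: [:: P 1 1; 0; 0; - P 0 1]; [:: 0; Q 1 1; - Q 0 1; 0];
                   [:: 0; - Q 1 0; Q 0 0; 0]; [:: - P 1 0; 0; 0; P 0 0]].
suff /mulmx1_unit[] : spin_mx P Q *m S = 1%:M by [].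
by entries; rewrite mulmx4E !mx_of_rowsE mxE /=;
  first [ring | rewrite -detP; ring | rewrite -detQ; ring].
Qed.

(** The form Y V = W Y avoids the inverse of Y and leaves polynomial identities to check. *)
Lemma conj_one_vector {R : realType} (P Q : 'M[R]_2) (a b c d : R) :
  \det P = 1 -> \det Q = 1 ->
  spin_mx P Q *m one_vector a b c d =
  (\sum_(k < 4) (conj_coords P Q a b c d)`_k *: (one_vectors R)`_k) *m
  spin_mx P Q.
Proof.
rewrite !det_mx22 one_vectors_sum => detP detQ.
(* The left side is linear in the entries of [P] and [Q], the right side cubic; a factor [\det P] or
   [\det Q] on the left balances the degrees. *)
have p1 x : x = x * (P 0 0 * P 1 1 - P 0 1 * P 1 0) by rewrite detP mulr1.
have q1 x : x = x * (Q 0 0 * Q 1 1 - Q 0 1 * Q 1 0) by rewrite detQ mulr1.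
by rewrite /=; entries; rewrite !mulmx4E !mx_of_rowsE /=;
  first [rewrite [LHS]q1; field | rewrite [LHS]p1; field].
Qed.

Lemma Phi22_spin_mx {R : realType} (P Q : 'M[R]_2) :
  \det P = 1 -> \det Q = 1 -> Phi22 (spin_mx P Q) = Phi_mx P Q.
Proof.
move=> detP detQ; apply/matrixP => i j; rewrite mxE.
suff -> : spin_mx P Q *m tnth (one_vectors R) j =
    (\sum_(k < 4) Phi_mx P Q k j *: (one_vectors R)`_k) *m spin_mx P Q.
  by rewrite mulmxK ?spin_mx_unit// coord_sum_free// one_vectors_free.
under eq_bigr do rewrite mxE mx_of_rowsE.
rewrite (tnth_nth 0) {1}one_vectorsE.
by case: j => [[|[|[|[|?]]]] ?] //; exact: conj_one_vector.
Qed.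

(** * Determinant and invariant quadratic form *)

(** On 2x2 matrices, left multiplication by P has determinant [\det P ^+ 2], and right
    multiplication by [\adj Q] has determinant [\det Q ^+ 2]. *)
Lemma det_Phi_mx {R : realType} (P Q : 'M[R]_2) :
  \det (Phi_mx P Q) = (\det P * \det Q) ^+ 2.
Proof.
rewrite det_tr !det_mx22 det_mx_of_rows4.
by field.
Qed.

(** Polarization of the multiplicativity of the determinant on P M [\adj Q], since - det M = ad +
    bc. *)
Lemma conj_coords_form {R : realType} (P Q : 'M[R]_2)
    (a b c d a' b' c' d' : R) :
  let u := conj_coords P Q a b c d in
  let v := conj_coords P Q a' b' c' d' in
  u`_0 * v`_0 + u`_1 * v`_1 - u`_2 * v`_2 - u`_3 * v`_3 =
  \det P * \det Q * ((a * d' + d * a' + b * c' + c * b') / 2).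
Proof. by rewrite !det_mx22 /=; field. Qed.

Lemma trmx_I22_mul {R : realType} (A : 'M[R]_4) i j :
  (A^T *m I22 R *m A) i j =
  A 0 i * A 0 j + A 1 i * A 1 j - A 2 i * A 2 j - A 3 i * A 3 j.
Proof. by rewrite !mulmx4E !mx_of_rowsE !mxE /=; ring. Qed.

Lemma Phi_mx_SO22 {R : realType} (P Q : 'M[R]_2) :
  \det P = 1 -> \det Q = 1 -> SO22 (Phi_mx P Q).
Proof.
move=> detP detQ; split; last by rewrite det_Phi_mx detP detQ mulr1 expr1n.
by entries; rewrite trmx_I22_mul !Phi_mxE conj_coords_form detP detQ
  mx_of_rowsE /=; field.
Qed.

(** * Continuity, paths in SL(2,R) and the identity component *)

Lemma continuous_mx {T : topologicalType} {R : realType} m n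
    (f : T -> 'M[R]_(m, n)) :
  (forall i j, continuous (fun t => f t i j)) -> continuous f.
Proof.
move=> cf t; apply/cvg_mx_entourageP => A entA.
have near_ij (ij : 'I_m * 'I_n) :
    \forall s \near t, (f t ij.1 ij.2, f s ij.1 ij.2) \in A.
  have /cvg_app_entourageP/(_ A entA) := cf ij.1 ij.2 t.
  by apply: filterS => s; rewrite inE.
apply: filterS (filter_forall (nbhs_filter t) near_ij) => s fA i j.
exact: (fA (i, j)).
Qed.

Lemma continuous_mulmx {T : topologicalType} {R : realType} m n p
    (f : T -> 'M[R]_(m, n)) (g : T -> 'M[R]_(n, p)) :
  continuous f -> continuous g -> continuous (fun t => f t *m g t).
Proof.
have coord k l (h : T -> 'M[R]_(k, l)) i j :
    continuous h -> continuous (fun t => h t i j).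
  move=> ch t.
  exact: (continuous_comp (ch t) (@coord_continuous R k l i j (h t))).
move=> cf cg; apply: continuous_mx => i j t.
rewrite (_ : (fun _ => _) = fun t => \sum_k f t i k * g t k j); last first.
  by apply/funext => s; rewrite mxE.
apply: cvg_big => [|k _]; first exact: add_continuous.
by apply: cvgM; apply: coord.
Qed.

Definition upper {R : realType} (x : R) : 'M[R]_2 :=
  mx_of_rows 2 [:: [:: 1; x]; [:: 0; 1]].
Definition lower {R : realType} (x : R) : 'M[R]_2 :=
  mx_of_rows 2 [:: [:: 1; 0]; [:: x; 1]].

(* If the lower left entry c of P is nonzero, then P = U(x) L(c) U(y); scaling
   the parameters of the factors by t joins P to the identity. *)
Lemma SL2_path {R : realType} (P : 'M[R]_2) : \det P = 1 ->
  exists g : R -> 'M[R]_2,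
    [/\ continuous g, forall t, \det (g t) = 1, g 0 = 1%:M & g 1 = P].
Proof.
pose joined (P : 'M[R]_2) := exists g : R -> 'M[R]_2,
  [/\ continuous g, forall t, \det (g t) = 1, g 0 = 1%:M & g 1 = P].
have joinedM A B : joined A -> joined B -> joined (A *m B).
  move=> [g [cg dg g0 g1]] [h [ch dh h0 h1]].
  exists (fun t => g t *m h t); split=> [|t||].
  - exact: continuous_mulmx.
  - by rewrite det_mulmx dg dh mulr1.
  - by rewrite g0 h0 mulmx1.
  - by rewrite g1 h1.
have cont_scale (x : R) : continuous (fun t : R => t * x).
  by move=> t; apply: cvgM; [exact: cvg_id|exact: cvg_cst].
have joinedU x : joined (upper x).
  exists (fun t => upper (t * x)); split=> [|t||].
  - apply: continuous_mx => i j.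
    rewrite (_ : (fun _ => _) =
        fun t : R => nth 0 (nth [::] [:: [:: 1; t * x]; [:: 0; 1]] i) j).
      by case: i j => [[|[|?]] ?] // [[|[|?]] ?] //= t; exact: cvg_cst.
    by apply/funext => t; rewrite mx_of_rowsE.
  - by rewrite det_mx22 !mx_of_rowsE /=; ring.
  - by apply: mx2P; rewrite mx_of_rowsE mxE /= ?mul0r.
  - by rewrite mul1r.
have joinedL x : joined (lower x).
  exists (fun t => lower (t * x)); split=> [|t||].
  - apply: continuous_mx => i j.
    rewrite (_ : (fun _ => _) =
        fun t : R => nth 0 (nth [::] [:: [:: 1; 0]; [:: t * x; 1]] i) j).
      by case: i j => [[|[|?]] ?] // [[|[|?]] ?] //= t; exact: cvg_cst.
    by apply/funext => t; rewrite mx_of_rowsE.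
  - by rewrite det_mx22 !mx_of_rowsE /=; ring.
  - by apply: mx2P; rewrite mx_of_rowsE mxE /= ?mul0r.
  - by rewrite mul1r.
have joined_ne0 A : \det A = 1 -> A 1 0 != 0 -> joined A.
  rewrite det_mx22 => dA c0.
  have -> : A = upper ((A 0 0 - 1) / A 1 0) *m
      (lower (A 1 0) *m upper ((A 1 1 - 1) / A 1 0)).
    apply: mx2P; rewrite !mulmx2E !mx_of_rowsE /=; try by field.
    have bc : A 0 1 * A 1 0 = A 0 0 * A 1 1 - 1 by rewrite -dA; ring.
    by apply: (mulIf c0); rewrite bc; field.
  exact: (joinedM _ _ (joinedU _) (joinedM _ _ (joinedL _) (joinedU _))).
rewrite -/(joined P) => dP.
have [c0|] := eqVneq (P 1 0) 0; last exact: joined_ne0.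
(* If c = 0, adding the first row to the second puts [P 0 0] in the lower left corner, and it is
   nonzero because the determinant is 1. *)
have -> : P = lower (-1) *m (lower 1 *m P).
  by apply: mx2P; rewrite !mulmx2E !mx_of_rowsE /=; ring.
apply: joinedM => //; apply: joined_ne0.
  by rewrite det_mulmx dP mulr1 det_mx22 !mx_of_rowsE /=; ring.
rewrite mulmx2E !mx_of_rowsE /= c0 mul1r mulr0 addr0.
apply: contra_eq_neq dP => P00.
by rewrite det_mx22 c0 P00 mul0r mulr0 subr0 eq_sym oner_neq0.
Qed.

Lemma continuous_Phi_mx {R : realType} (g h : R -> 'M[R]_2) :
  continuous g -> continuous h -> continuous (fun t => Phi_mx (g t) (h t)).
Proof.
move=> cg ch; apply: continuous_mx => i j t.
have cgE k l : (fun t => g t k l) @ t --> g t k l.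
  exact: (continuous_comp (cg t) (@coord_continuous R _ _ k l (g t))).
have chE k l : (fun t => h t k l) @ t --> h t k l.
  exact: (continuous_comp (ch t) (@coord_continuous R _ _ k l (h t))).
have coords_cvg a b c d (n : 'I_4) :
    (conj_coords (g x) (h x) a b c d)`_n @[x --> t] -->
    (conj_coords (g t) (h t) a b c d)`_n.
  have D (u v : R -> R) (l m : R) :
    u x @[x --> t] --> l -> v x @[x --> t] --> m ->
    u x + v x @[x --> t] --> l + m by exact: cvgD.
  have B (u v : R -> R) (l m : R) :
    u x @[x --> t] --> l -> v x @[x --> t] --> m ->
    u x - v x @[x --> t] --> l - m by exact: cvgB.
  have M (u v : R -> R) (l m : R) :
    u x @[x --> t] --> l -> v x @[x --> t] --> m ->
    u x * v x @[x --> t] --> l * m by exact: cvgM.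
  have K (u : R -> R) (l r : R) :
      u x @[x --> t] --> l -> u x * r @[x --> t] --> l * r.
    by move=> ul; apply: M => //; exact: cvg_cst.
  (* [U k] and [V k] are the limits for the two entries in row [k] of P M; the next four are those
     for P M [\adj Q], with the sign of the last entry reversed. *)
  have U k := D _ _ _ _ (K _ _ a (cgE k 0)) (K _ _ c (cgE k 1)).
  have V k := B _ _ _ _ (K _ _ b (cgE k 0)) (K _ _ d (cgE k 1)).
  have a' := B _ _ _ _ (M _ _ _ _ (U 0) (chE 1 1)) (M _ _ _ _ (V 0) (chE 1 0)).
  have b' := B _ _ _ _ (M _ _ _ _ (V 0) (chE 0 0)) (M _ _ _ _ (U 0) (chE 0 1)).
  have c' := B _ _ _ _ (M _ _ _ _ (U 1) (chE 1 1)) (M _ _ _ _ (V 1) (chE 1 0)).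
  have d' := B _ _ _ _ (M _ _ _ _ (U 1) (chE 0 1)) (M _ _ _ _ (V 1) (chE 0 0)).
  case: n => [[|[|[|[|?]]]] ?] //.
  - exact: K (D _ _ _ _ a' d').
  - exact: K (D _ _ _ _ b' c').
  - exact: K (B _ _ _ _ a' d').
  - exact: K (B _ _ _ _ b' c').
rewrite /continuous_at; under eq_cvg do rewrite Phi_mxE.
rewrite Phi_mxE.
by case: j => [[|[|[|[|?]]]] ?] //; exact: coords_cvg.
Qed.

Lemma Phi_mx1 {R : realType} : Phi_mx 1%:M 1%:M = 1%:M :> 'M[R]_4.
Proof. by entries; rewrite Phi_mxE !mxE /= ?mxE /=; field. Qed.

(** Paths from the identity to P and to Q map [0, 1] onto a connected subset of [SO22] through the
    identity. *)
Lemma Phi_mx_SO22plus {R : realType} (P Q : 'M[R]_2) :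
  \det P = 1 -> \det Q = 1 -> SO22plus (Phi_mx P Q).
Proof.
move=> /SL2_path[g [cg dg g0 g1]] /SL2_path[h [ch dh h0 h1]].
pose path (t : R) := Phi_mx (g t) (h t).
apply: (@connected_component_max _ _ (path @` `[0, 1])).
- by exists 0; [rewrite /= in_itv /= lexx ler01|rewrite /path g0 h0 Phi_mx1].
- by move=> _ [t _ <-]; exact: Phi_mx_SO22.
- apply: connected_continuous_connected; first exact: segment_connected.
  by apply: continuous_subspaceT; exact: continuous_Phi_mx.
- by exists 1; [rewrite /= in_itv /= lexx ler01|rewrite /path g1 h1].
Qed.

(** * Fibres of the covering map *)

Lemma Phi_mx_inj {R : realType} (P Q P' Q' : 'M[R]_2) :
  \det P = 1 -> \det Q = 1 -> \det P' = 1 -> \det Q' = 1 ->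
  Phi_mx P Q = Phi_mx P' Q' ->
  (P = P' /\ Q = Q') \/ (P = - P' /\ Q = - Q').
Proof.
rewrite !det_mx22 => dP dQ dP' dQ' /matrixP eqPhi.
(* The sixteen entries of [Phi_mx] are independent linear forms in the sixteen products, so each
   product is recovered linearly. *)
have PQ i j k l : P i j * Q k l = P' i j * Q' k l.
  have := eqPhi 0 0; have := eqPhi 1 0; have := eqPhi 2 0; have := eqPhi 3 0.
  have := eqPhi 0 1; have := eqPhi 1 1; have := eqPhi 2 1; have := eqPhi 3 1.
  have := eqPhi 0 2; have := eqPhi 1 2; have := eqPhi 2 2; have := eqPhi 3 2.
  have := eqPhi 0 3; have := eqPhi 1 3; have := eqPhi 2 3; have := eqPhi 3 3.
  rewrite !Phi_mxE /=.
  by case: (ord2P i) => ->; case: (ord2P j) => ->; case: (ord2P k) => ->;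
    case: (ord2P l) => ->; clear => *; lra.
(* The products P i j * Q k l determine P and Q up to inverse scalars, which the
   determinants force to be a common sign mu. *)
pose mu := Q 0 0 * Q' 1 1 - Q 0 1 * Q' 1 0.
(* Multiplying by [\det Q'] creates products of an entry of [P'] and one of [Q'], which [PQ]
   replaces; what remains beside [P i j] is [mu]. *)
have P'E i j : P' i j = mu * P i j.
  rewrite -[LHS]mulr1 -dQ' mulrBr !mulrA -!PQ /mu; ring.
have mu2 : mu ^+ 2 = 1 by rewrite -dP' !P'E -[LHS]mulr1 -dP; ring.
have QE k l : Q' k l = mu * Q k l.
  rewrite -[LHS]mul1r -dP' mulrBl ![_ * _ * Q' k l]mulrAC -!PQ.
  rewrite -[RHS]mulr1 -dP !P'E; ring.
move/eqP: mu2; rewrite sqrf_eq1 => /orP[] /eqP mu1; [left|right];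
  by split; apply/matrixP => i j;
    rewrite ?mxE ?P'E ?QE mu1 ?mul1r ?mulN1r ?opprK.
Qed.

(** Bilinearity of [Phi_mx] makes a common sign invisible, and [Phi_mx_inj] excludes any other
    preimage. *)
Lemma Phi22_preimageE {R : realType} (P Q : 'M[R]_2) (X Y : 'M[R]_4) :
  \det P = 1 -> \det Q = 1 -> Phi_mx P Q = X -> spin_mx P Q = Y ->
  Phi22_preimage X = [set Y; - Y].
Proof.
move=> dP dQ <- <-.
have dN (A : 'M[R]_2) : \det A = 1 -> \det (- A) = 1.
  by rewrite !det_mx22 => <-; rewrite !mxE; ring.
have spinN : - spin_mx P Q = spin_mx (- P) (- Q).
  by entries; rewrite mxE !mx_of_rowsE /= ?mxE ?oppr0.
have PhiN : Phi_mx (- P) (- Q) = Phi_mx P Q.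
  rewrite /Phi_mx; congr (mx_of_rows 4 _)^T.
  have coordsN a b c d :
      conj_coords (- P) (- Q) a b c d = conj_coords P Q a b c d.
    by rewrite /conj_coords !mxE; congr [:: _; _; _; _]; ring.
  by rewrite !coordsN.
have [dNP dNQ] := (dN _ dP, dN _ dQ).
apply/seteqP; split=> [Y' [/Spin22P[P' [Q' [-> dP' dQ']]]]|Y' [] ->].
- rewrite Phi22_spin_mx // => /Phi_mx_inj[] // [-> ->]; first by left.
  by right; rewrite spinN.
- by split; [apply/Spin22P; exists P, Q|rewrite Phi22_spin_mx].
- rewrite spinN; split; first by apply/Spin22P; exists (- P), (- Q).
  by rewrite Phi22_spin_mx.
Qed.

(** * Explicit preimages of the Givens matrices *)

Theorem theorem28 (R : realType) (theta beta : R)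
    (theta_range : 0 <= theta <= 2 * pi) :
  let c := cos (theta / 2) in
  let s := sin (theta / 2) in
  let p := expR (beta / 2) in
  let q := expR (- (beta / 2)) in
  let A := mx_of_rows 4 [:: [:: c; 0; 0; - s];
                            [:: 0; c; - s; 0];
                            [:: 0; s; c; 0];
                            [:: s; 0; 0; c]] in
  let B := mx_of_rows 4 [:: [:: c; 0; 0; s];
                            [:: 0; c; - s; 0];
                            [:: 0; s; c; 0];
                            [:: - s; 0; 0; c]] in
  let C := mx_of_rows 4 [:: [:: p; 0; 0; 0];
                            [:: 0; q; 0; 0];
                            [:: 0; 0; p; 0];
                            [:: 0; 0; 0; q]] in
  let D := mx_of_rows 4 [:: [:: p; 0; 0; 0];
                            [:: 0; p; 0; 0];
                            [:: 0; 0; q; 0];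
                            [:: 0; 0; 0; q]] in
  set_fun (@Spin22 R) (@SO22plus R) (@Phi22 R) /\
  [/\ Phi22_preimage (R12 theta) = [set A; - A],
      Phi22_preimage (R34 theta) = [set B; - B],
      Phi22_preimage (H13 beta) = [set C; - C] &
      Phi22_preimage (H24 beta) = [set D; - D]].
Proof.
move=> c s p q A B C D; split.
  move=> Y /Spin22P[P [Q [-> dP dQ]]].
  by rewrite Phi22_spin_mx//; exact: Phi_mx_SO22plus.
(* Half-argument formulas; [cs] and [pq] also account for the diagonal entries 1 of the Givens
   matrices. *)
have cs : c ^+ 2 + s ^+ 2 = 1 by exact: cos2Dsin2.
have pq : p * q = 1 by rewrite -expRD subrr expR0.
have cosE : cos theta = c ^+ 2 - s ^+ 2 by rewrite [theta]splitr cosD -!expr2.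
have sinE : sin theta = 2 * (s * c).
  by rewrite [theta]splitr sinD -/c -/s; ring.
have coshE : cosh beta = (p ^+ 2 + q ^+ 2) / 2.
  by rewrite /cosh [beta]splitr opprD !expRD !expr2.
have sinhE : sinh beta = (p ^+ 2 - q ^+ 2) / 2.
  by rewrite /sinh [beta]splitr opprD !expRD !expr2.
(* [rotV] and [dilV] are the inverses of [rot] and [dil]. *)
pose rot := mx_of_rows 2 [:: [:: c; - s]; [:: s; c]].
pose rotV := mx_of_rows 2 [:: [:: c; s]; [:: - s; c]].
pose dil := mx_of_rows 2 [:: [:: p; 0]; [:: 0; q]].
pose dilV := mx_of_rows 2 [:: [:: q; 0]; [:: 0; p]].
have drot : \det rot = 1 by rewrite det_mx22 !mx_of_rowsE /= -cs; ring.
have drotV : \det rotV = 1 by rewrite det_mx22 !mx_of_rowsE /= -cs; ring.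
have ddil : \det dil = 1 by rewrite det_mx22 !mx_of_rowsE /= -pq; ring.
have ddilV : \det dilV = 1 by rewrite det_mx22 !mx_of_rowsE /= -pq; ring.
split.
(* Conjugation by [rot] fixes the identity and [isigma_y], hence the third and fourth
   one-vectors. *)
- apply: (Phi22_preimageE _ _ _ _ drot drot);
    last by rewrite /spin_mx !mx_of_rowsE.
  by entries; rewrite Phi_mxE [RHS]mxE /= !mx_of_rowsE /= ?cosE ?sinE;
    first [field | rewrite -[RHS]cs; field].
(* Multiplication by [rotV] on both sides fixes [sigma_z] and [sigma_x]. *)
- apply: (Phi22_preimageE _ _ _ _ drotV drot);
    last by rewrite /spin_mx !mx_of_rowsE.
  by entries; rewrite Phi_mxE [RHS]mxE /= !mx_of_rowsE /= ?cosE ?sinE;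
    first [field | rewrite -[RHS]cs; field].
(* Multiplication by [dil] on both sides fixes the antidiagonal matrices. *)
- apply: (Phi22_preimageE _ _ _ _ ddil ddilV);
    last by rewrite /spin_mx !mx_of_rowsE.
  by entries; rewrite Phi_mxE [RHS]mxE /= !mx_of_rowsE /= ?coshE ?sinhE;
    first [field | rewrite -[RHS]pq; field].
(* Conjugation by [dil] fixes the diagonal matrices. *)
- apply: (Phi22_preimageE _ _ _ _ ddil ddil);
    last by rewrite /spin_mx !mx_of_rowsE.
  by entries; rewrite Phi_mxE [RHS]mxE /= !mx_of_rowsE /= ?coshE ?sinhE;
    first [field | rewrite -[RHS]pq; field].
Qed.
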